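(* Let $F\in\mathbb{Z}_{\ge 0}$ and consider a network of $n$ agents given by a finite (directed or undirected) graph $(\mathcal{V},\mathcal{E})$, with leader set $\mathcal{L}\subset\mathcal{V}$, misbehaving set $\mathcal{A}\subseteq\mathcal{V}$ and normal agents $\mathcal{N}=\mathcal{V}\setminus(\mathcal{L}\cup\mathcal{A})$. Assume the leaders are trusted, i.e. $\mathcal{L}\cap\mathcal{A}=\emptyset$, that $\mathcal{A}$ satisfies the $F$-local adversary model, and that the normal agents apply the W-MSR algorithm with parameter $F$. Suppose there exist a time $t_C$ and a constant $C_L\in\mathbb{R}$ such that the reference signal satisfies $x_r[t]=C_L$ for all $t\ge t_C$. If the network is trusted leader-follower (TLF) robust with parameter $F$ (with respect to the set $S=\mathcal{L}$), then $$\lim_{t\to\infty}|x_i[t]-x_r[t]|=0\quad\text{for all } i\in\mathcal{N}.$$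
   Context: Graph: $\mathcal{V}=\{1,\dots,n\}$ is the set of agents; an edge $(j,i)\in\mathcal{E}$ ($j\ne i$) means that $i$ receives information from $j$. In-neighbors: $\mathcal{V}_i=\{j:(j,i)\in\mathcal{E}\}$; inclusive neighbors: $\mathcal{J}_i=\mathcal{V}_i\cup\{i\}$. Undirected graphs are treated as digraphs with $(i,j)\in\mathcal{E}\iff(j,i)\in\mathcal{E}$. Time is discrete, $t\in\mathbb{Z}_{\ge0}$, and agents have real-valued states $x_i[t]$. Reference: $x_r[t]\in\mathbb{R}$ is a reference signal with $x_r[t+1]=f_r(t,x_r[t])$, where $f_r$ is a (time-dependent) step function. Agents: $\mathcal{V}=\mathcal{N}\cup\mathcal{L}\cup\mathcal{A}$. Agents in $\mathcal{L}\setminus\mathcal{A}$ behave as leaders: $x_i[t]=x_r[t]$ for all $t$. Agents in $\mathcal{A}$ are misbehaving: at each time they may send arbitrary real values, possibly different ones to different out-neighbors. Agents not in $\mathcal{A}$ send their true state $x_j[t]$ to all out-neighbors. Receivers do not know which type their in-neighbors are. $F$-local adversary model: $|\mathcal{J}_i\cap\mathcal{A}|\le F$ for all $i\in\mathcal{N}$. W-MSR algorithm with parameter $F$ (for each $i\in\mathcal{N}$, at each $t$): agent $i$ sorts the values received from $\mathcal{J}_i$ (including its own value). If at most $F$ of these values are strictly greater than $x_i[t]$, it removes all of them; otherwise it removes the $F$ largest values (ties broken arbitrarily). Likewise, if at most $F$ values are strictly less than $x_i[t]$, it removes all of them; otherwise it removes the $F$ smallest. Let $\mathcal{R}_i[t]\subseteq\mathcal{J}_i$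 be the set of agents whose values remain (so $i\in\mathcal{R}_i[t]$). Then $x_i[t+1]=\sum_{j\in\mathcal{R}_i[t]}w_{ij}[t]\,x_j[t]$, where $x_j[t]$ is the value received by $i$ from $j$. The weights satisfy $w_{ij}[t]=0$ for $j\notin\mathcal{R}_i[t]$, $w_{ij}[t]\ge\alpha$ for $j\in\mathcal{R}_i[t]$, and $\sum_j w_{ij}[t]=1$, for a fixed constant $0<\alpha<1$ independent of $i,j,t$. Reachability: a nonempty set $C\subseteq\mathcal{V}$ is $r$-reachable if there is $i\in C$ with $|\mathcal{V}_i\setminus C|\ge r$. TLF robustness: the network is trusted leader-follower robust with parameter $F$ (with respect to $S\subset\mathcal{V}$) if for every nonempty $C\subseteq\mathcal{V}\setminus S$ at least one of the following holds: (i) there exists $i\in C$ with $|\mathcal{V}_i\cap S|\ge F+1$; (ii) $C$ is $(2F+1)$-reachable. *)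

(* Defs.v *)
From HB Require Import structures.
From mathcomp Require Import all_boot all_order all_algebra.
From mathcomp Require Import reals topology normedtype sequences.

Set Implicit Arguments.
Unset Strict Implicit.
Unset Printing Implicit Defensive.

Import Order.TTheory GRing.Theory Num.Theory.
Import numFieldNormedType.Exports.

Local Open Scope ring_scope.

(** Agents are the elements of ['I_n].  For [e : rel 'I_n], [e j i] is the edge
    (j, i), meaning that [i] receives information from [j].  An undirected graph
    is the case where [e] is symmetric. *)

Definition in_nbrs (n : nat) (e : rel 'I_n) (i : 'I_n) : {set 'I_n} :=
  [set j | e j i].

Definition incl_nbrs (n : nat) (e : rel 'I_n) (i : 'I_n) : {set 'I_n} :=
  i |: in_nbrs e i.

Definition reachable (n : nat) (e : rel 'I_n) (r : nat) (C : {set 'I_n}) : Prop :=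
  exists2 i, i \in C & (r <= #|in_nbrs e i :\: C|)%N.

Definition tlf_robust (n : nat) (e : rel 'I_n) (F : nat) (S : {set 'I_n}) : Prop :=
  forall C : {set 'I_n}, C != finset.set0 -> C \subset ~: S ->
    (exists2 i, i \in C & (F + 1 <= #|in_nbrs e i :&: S|)%N)
    \/ reachable e (2 * F + 1) C.

Definition normal (n : nat) (L A : {set 'I_n}) : {set 'I_n} := ~: (L :|: A).

Definition F_local (n : nat) (e : rel 'I_n) (F : nat) (L A : {set 'I_n}) : Prop :=
  forall i, i \in normal L A -> (#|incl_nbrs e i :&: A| <= F)%N.

Definition leaders_follow (R : realType) (n : nat) (L A : {set 'I_n})
    (xr : nat -> R) (x : nat -> 'I_n -> R) : Prop :=
  forall t i, i \in L :\: A -> x t i = xr t.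

(** [m t j i] is the value sent by [j] to [i] at time [t].  It is left
    unconstrained when [j \in A], so that a misbehaving agent may send different
    values to different out-neighbours. *)
Definition truthful (R : realType) (n : nat) (e : rel 'I_n) (A : {set 'I_n})
    (x : nat -> 'I_n -> R) (m : nat -> 'I_n -> 'I_n -> R) : Prop :=
  forall t j i, j \notin A -> e j i -> m t j i = x t j.

(** The value that [i] attributes to [j] at time [t]; an agent uses its own state
    without any transmission. *)
Definition received (R : realType) (n : nat) (x : nat -> 'I_n -> R)
    (m : nat -> 'I_n -> 'I_n -> R) (t : nat) (i j : 'I_n) : R :=
  if j == i then x t i else m t j i.

(** One side of the W-MSR rule.  [removes_high F J v c H]: among the values [v j], [j \in J], an agent whose own
    value is [c] may discard exactly those indexed by [H] on the high side.
    Being a relation rather than a function, it allows any tie-breaking in the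
    choice of the [F] largest values. *)

Definition removes_high (R : realType) (n F : nat) (J : {set 'I_n})
    (v : 'I_n -> R) (c : R) (H : {set 'I_n}) : Prop :=
  let G := [set j in J | c < v j] in
  if (#|G| <= F)%N then H = G
  else [/\ H \subset J, #|H| = F &
           forall j k, j \in H -> k \in J :\: H -> v k <= v j].

Definition removes_low (R : realType) (n F : nat) (J : {set 'I_n})
    (v : 'I_n -> R) (c : R) (H : {set 'I_n}) : Prop :=
  let G := [set j in J | v j < c] in
  if (#|G| <= F)%N then H = G
  else [/\ H \subset J, #|H| = F &
           forall j k, j \in H -> k \in J :\: H -> v j <= v k].

(** [K] is the set of agents whose values remain at an agent with inclusive
    neighbours [J] and own value [c]. *)
Definition wmsr_retains (R : realType) (n F : nat) (J : {set 'I_n})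
    (v : 'I_n -> R) (c : R) (K : {set 'I_n}) : Prop :=
  exists H1 H2 : {set 'I_n},
    [/\ removes_high F J v c H1, removes_low F J v c H2 &
        K = J :\: (H1 :|: H2)].

Definition admissible_weights (R : realType) (n : nat) (alpha : R)
    (K : {set 'I_n}) (w : 'I_n -> R) : Prop :=
  [/\ forall j, j \notin K -> w j = 0,
      forall j, j \in K -> alpha <= w j &
      \sum_j w j = 1].

Definition applies_wmsr (R : realType) (n : nat) (e : rel 'I_n) (F : nat)
    (alpha : R) (x : nat -> 'I_n -> R) (m : nat -> 'I_n -> 'I_n -> R)
    (w : nat -> 'I_n -> 'I_n -> R) (K : nat -> 'I_n -> {set 'I_n})
    (i : 'I_n) : Prop :=
  forall t,
    [/\ wmsr_retains F (incl_nbrs e i) (received x m t i) (x t i) (K t i),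
        admissible_weights alpha (K t i) (w t i) &
        x t.+1 i = \sum_(j in K t i) w t i j * received x m t i j].

(* Main.v *)
Require Import Defs.
From HB Require Import structures.
From mathcomp Require Import all_boot all_order all_algebra.
From mathcomp Require Import reals topology normedtype sequences.
From mathcomp Require Import zify ring.

Set Implicit Arguments.
Unset Strict Implicit.
Unset Printing Implicit Defensive.

Import Order.TTheory GRing.Theory Num.Theory.
Import numFieldNormedType.Exports.

Local Open Scope classical_set_scope.
Local Open Scope ring_scope.

(** Let [c] be the final value of the reference and let [M >= c] bound the states
    of all agents outside [A] at some time [t].  W-MSR never keeps a value above
    [M], and an agent that keeps some value at most [b] moves to a state at most
    [M - alpha * (M - b)].  Robustness, applied to the set [C] of normal agents
    not yet known to be below [M - alpha ^+ k * (M - c)] at time [t + k], yields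
    one agent of [C] that keeps a value from outside [C]; so [C] loses an agent
    at every step and is empty after [n] steps.  Hence the excess over [c] is
    multiplied by [1 - alpha ^+ n] every [n] steps.  The bound from below is the
    same argument for the opposite states. *)


(** * The W-MSR removal rule and its symmetry under negation *)

(** When more than [F] values exceed [c], the [F] removed agents cannot include all of theirs, and
    each removed value is at least as large as one left behind. *)
Lemma removes_highP (R : realType) (n F : nat) (J : {set 'I_n})
    (v : 'I_n -> R) (c : R) (H : {set 'I_n}) :
  removes_high F J v c H ->
  (#|H| <= F)%N /\ forall j, j \in H -> c < v j.
Proof.
rewrite /removes_high; case: leqP => [leGF -> | ltFG [sHJ cardH maxH]].
  by split=> // j; rewrite inE => /andP[].
split=> [|j jH]; first by rewrite cardH.
have /subsetPn[k] : ~~ ([set j in J | c < v j] \subset H).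
  by apply: contraL ltFG => /subset_leq_card; rewrite cardH -leqNgt.
rewrite inE => /andP[kJ ltck] kH.
by apply: lt_le_trans ltck _; apply: maxH => //; rewrite inE kH.
Qed.

Lemma removes_high_opp (R : realType) (n F : nat) (J : {set 'I_n})
    (v : 'I_n -> R) (c : R) (H : {set 'I_n}) :
  removes_high F J v c H -> removes_low F J (fun j => - v j) (- c) H.
Proof.
rewrite /removes_high /removes_low.
have -> : [set j in J | - v j < - c] = [set j in J | c < v j].
  by apply/setP => j; rewrite !inE ltrN2.
case: leqP => // _ [sHJ cardH maxH]; split=> // j k jH kJ.
by rewrite lerN2; apply: maxH.
Qed.

Lemma removes_low_opp (R : realType) (n F : nat) (J : {set 'I_n})
    (v : 'I_n -> R) (c : R) (H : {set 'I_n}) :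
  removes_low F J v c H -> removes_high F J (fun j => - v j) (- c) H.
Proof.
rewrite /removes_high /removes_low.
have -> : [set j in J | - c < - v j] = [set j in J | v j < c].
  by apply/setP => j; rewrite !inE ltrN2.
case: leqP => // _ [sHJ cardH minH]; split=> // j k jH kJ.
by rewrite lerN2; apply: minH.
Qed.

Lemma removes_lowP (R : realType) (n F : nat) (J : {set 'I_n})
    (v : 'I_n -> R) (c : R) (H : {set 'I_n}) :
  removes_low F J v c H ->
  (#|H| <= F)%N /\ forall j, j \in H -> v j < c.
Proof.
move=> /removes_low_opp /removes_highP[cardH gtH]; split=> // j /gtH.
by rewrite ltrN2.
Qed.

Lemma wmsr_retains_opp (R : realType) (n F : nat) (J : {set 'I_n})
    (v : 'I_n -> R) (c : R) (K : {set 'I_n}) :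
  wmsr_retains F J v c K -> wmsr_retains F J (fun j => - v j) (- c) K.
Proof.
move=> [H1 [H2 [high low ->]]]; exists H2, H1; rewrite finset.setUC.
by split=> //; [apply: removes_low_opp | apply: removes_high_opp].
Qed.

Lemma wmsr_retains_self (R : realType) (n F : nat) (J K : {set 'I_n})
    (v : 'I_n -> R) (i : 'I_n) :
  wmsr_retains F J v (v i) K -> i \in J -> i \in K.
Proof.
move=> [H1 [H2 [/removes_highP[_ gtH1] /removes_lowP[_ ltH2] ->]]] iJ.
rewrite !inE iJ andbT negb_or.
by apply/andP; split; [apply/negP => /gtH1 | apply/negP => /ltH2]; rewrite ltxx.
Qed.

Lemma wmsr_retains_le (R : realType) (n F : nat) (J K A : {set 'I_n})
    (v : 'I_n -> R) (c M : R) :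
  wmsr_retains F J v c K -> (#|J :&: A| <= F)%N -> c <= M ->
  (forall j, j \in J :\: A -> v j <= M) -> forall j, j \in K -> v j <= M.
Proof.
move=> [H1 [H2 [high _ ->]]] JA cM leM j.
rewrite !inE negb_or => /andP[/andP[jH1 _] jJ].
move: high; rewrite /removes_high; case: leqP => [_ eqH1 | _ [sHJ cardH maxH]].
  by move: jH1; rewrite eqH1 inE jJ /= -leNgt => /le_trans; apply.
(* Among [j] and the [F] removed values, all at least [v j], one is honest. *)
have /subsetPn[k kjH] : ~~ (j |: H1 \subset J :&: A).
  apply/negP => /subset_leq_card; rewrite cardsU1 jH1 cardH add1n.
  by move=> /leq_trans/(_ JA); rewrite ltnn.
have kJ : k \in J.
  by move: kjH; rewrite !inE => /orP[/eqP-> // | /(subsetP sHJ)].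
rewrite inE kJ /= => kA.
have vkM : v k <= M by apply: leM; rewrite inE kA kJ.
move: kjH; rewrite !inE => /orP[/eqP<- // | kH].
by apply: le_trans vkM; apply: maxH => //; rewrite inE jH1 jJ.
Qed.

(** The low side discards at most [F] agents, so it spares some [j] in [S]; the high side discards
    only values above [c], while [v j <= b <= c]. *)
Lemma wmsr_retains_low (R : realType) (n F : nat) (J K S : {set 'I_n})
    (v : 'I_n -> R) (c b : R) :
  wmsr_retains F J v c K -> S \subset J -> (F < #|S|)%N -> b <= c ->
  (forall j, j \in S -> v j <= b) -> exists2 j, j \in K & v j <= b.
Proof.
move=> [H1 [H2 [/removes_highP[_ gtH1] /removes_lowP[cardH2 _] ->]]].
move=> sSJ ltFS bc leb.
have /subsetPn[j jS jH2] : ~~ (S \subset H2).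
  by apply: contraL ltFS => /subset_leq_card/leq_trans/(_ cardH2); rewrite -leqNgt.
exists j; last exact: leb.
rewrite !inE (subsetP sSJ) // andbT negb_or jH2 andbT.
apply/negP => /gtH1; apply/negP; rewrite -leNgt.
exact: le_trans (leb _ jS) bc.
Qed.

(** * One weighted update *)

(** Since the weights sum to 1, the update falls short of [M] by [\sum_(k in K) w k * (M - v k)];
    all terms are nonnegative and that of [j] is at least [alpha * (M - b)]. *)
Lemma admissible_weights_sum_le (R : realType) (n : nat) (alpha M b : R)
    (K : {set 'I_n}) (w v : 'I_n -> R) (j : 'I_n) :
  0 <= alpha -> b <= M -> admissible_weights alpha K w ->
  (forall k, k \in K -> v k <= M) -> j \in K -> v j <= b ->
  \sum_(k in K) w k * v k <= M - alpha * (M - b).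
Proof.
move=> alpha0 bM [w0 wK w1] leM jK vjb.
have sumK : \sum_(k in K) w k = 1.
  rewrite -w1 big_mkcond; apply: eq_bigr => k _.
  by case: ifPn => // /w0.
have -> : \sum_(k in K) w k * v k = M - \sum_(k in K) w k * (M - v k).
  under [in RHS]eq_bigr do rewrite mulrBr.
  by rewrite sumrB -mulr_suml sumK mul1r opprB addrC subrK.
rewrite lerD2l lerN2 (bigD1 j) //= -[X in X <= _]addr0.
apply: lerD; first by apply: ler_pM; rewrite ?subr_ge0 ?wK // lerD2l lerN2.
apply: sumr_ge0 => k /andP[kK _].
by rewrite mulr_ge0 ?subr_ge0 ?leM // (le_trans alpha0) ?wK.
Qed.

Lemma wmsr_update_le (R : realType) (n F : nat) (J K A : {set 'I_n})
    (alpha M b : R) (w v : 'I_n -> R) (i : 'I_n) :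
  0 <= alpha -> b <= M -> i \in J :\: A -> (#|J :&: A| <= F)%N ->
  wmsr_retains F J v (v i) K -> admissible_weights alpha K w ->
  (forall j, j \in J :\: A -> v j <= M) ->
  v i <= b \/ (exists S : {set 'I_n},
    [/\ S \subset J, (F < #|S|)%N & forall j, j \in S -> v j <= b]) ->
  \sum_(j in K) w j * v j <= M - alpha * (M - b).
Proof.
move=> alpha0 bM iJA JA ret adm leM low.
have iJ : i \in J by move: iJA; rewrite inE => /andP[].
have [j jK vjb] : exists2 j, j \in K & v j <= b.
  have iK := wmsr_retains_self ret iJ.
  (* [S] is called upon only when [b < v i]; otherwise the own value of [i], which is always kept,
     is low enough. *)
  case: (leP (v i) b) => [vib | bvi]; first by exists i.
  case: low => [vib | [S [SJ FS leb]]]; first by exists i.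
  exact: wmsr_retains_low ret SJ FS (ltW bvi) leb.
apply: (admissible_weights_sum_le alpha0 bM adm _ jK vjb).
exact: wmsr_retains_le ret JA (leM _ iJA) leM.
Qed.

(* The only consequence of W-MSR used for convergence; stated for arbitrary
   [y], so that it can be instantiated with both [x] and [- x]. *)
Definition contracting_above (R : realType) (n : nat) (e : rel 'I_n) (F : nat)
    (L A : {set 'I_n}) (alpha : R) (y : nat -> 'I_n -> R) : Prop :=
  forall t i M b, i \in normal L A -> b <= M ->
    (forall j, j \notin A -> y t j <= M) ->
    y t i <= b \/ (exists S : {set 'I_n},
      [/\ S \subset in_nbrs e i :\: A, (F < #|S|)%N &
          forall j, j \in S -> y t j <= b]) ->
    y t.+1 i <= M - alpha * (M - b).

(** * Geometric decay of the upper bound *)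

Section Contraction.
Variables (R : realType) (n F : nat) (e : rel 'I_n) (L A : {set 'I_n}).
Variables (alpha c : R) (y : nat -> 'I_n -> R) (tC : nat).
Hypothesis alpha01 : 0 < alpha < 1.
Hypothesis trusted : L :&: A = finset.set0.
Hypothesis local : F_local e F L A.
Hypothesis robust : tlf_robust e F L.
Hypothesis y_step : contracting_above e F L A alpha y.
Hypothesis y_leader : forall t i, (tC <= t)%N -> i \in L -> y t i = c.

Let notinA j : j \notin A -> j \in L \/ j \in normal L A.
Proof. by move=> jA; rewrite !inE (negbTE jA) orbF; case: (j \in L); [left|right]. Qed.

Let leader_notinA j : j \in L -> j \notin A.
Proof. by move=> jL; apply/negP => jA; have := in_set0 j; rewrite -trusted inE jL jA. Qed.

Let alpha_ge0 : 0 <= alpha. Proof. by case/andP: alpha01 => /ltW. Qed.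

Lemma upper_bound_stable t M : (tC <= t)%N -> c <= M ->
  (forall j, j \notin A -> y t j <= M) ->
  forall s j, j \notin A -> y (t + s)%N j <= M.
Proof.
move=> tCt cM leM; elim=> [|s IHs] j jA; first by rewrite addn0 leM.
case: (notinA jA) => [jL | jN].
  by rewrite (y_leader _ jL) // (leq_trans tCt) ?leq_addr.
(* With [b = M] the guaranteed decrease is zero, so a step preserves [M]. *)
rewrite addnS; have := y_step jN (lexx M) IHs (or_introl (IHs _ jA)).
by rewrite subrr mulr0 subr0.
Qed.

(** [C] collects the agents that may still exceed the current level. One application of
    [b -> M - alpha * (M - b)] turns each level into the next. *)
Lemma shrinking_set t M k : (tC <= t)%N -> c <= M ->
  (forall j, j \notin A -> y t j <= M) ->
  exists C : {set 'I_n}, [/\ C \subset normal L A, (#|C| <= n - k)%N &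
    forall j, j \notin A -> j \notin C ->
      y (t + k)%N j <= M - alpha ^+ k * (M - c)].
Proof.
move=> tCt cM leM; have stable := upper_bound_stable tCt cM leM.
elim: k => [|k [C [CN cardC leC]]].
  (* At [k = 0] the level is [c] itself, which is known only for the leaders. *)
  exists (normal L A); split=> // [|j jA jN].
    by rewrite subn0 -[X in (_ <= X)%N]card_ord max_card.
  case: (notinA jA) => [jL | jN']; last by rewrite jN' in jN.
  by rewrite expr0 mul1r subKr addn0 y_leader.
set b := M - alpha ^+ k * (M - c) in leC.
have bM : b <= M by rewrite gerBl mulr_ge0 ?exprn_ge0 // subr_ge0.
have cb : c <= b.
  rewrite lerBrDr -lerBrDl; apply: ler_piMl; rewrite ?subr_ge0 //.
  by case/andP: alpha01 => _ /ltW alpha1; rewrite exprn_ile1.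
have alphab : alpha * (M - b) = alpha ^+ k.+1 * (M - c).
  by rewrite subKr mulrA exprS.
(* No agent re-enters [C]: a leader stays at [c <= b], and a normal agent has its own state as the
   value at most [b]. *)
have outside j : j \notin A -> j \notin C ->
    y (t + k.+1)%N j <= M - alpha ^+ k.+1 * (M - c).
  move=> jA jC; case: (notinA jA) => [jL | jN].
    rewrite (y_leader _ jL) ?(leq_trans tCt) ?leq_addr // -alphab.
    apply: le_trans cb _; rewrite lerBrDr -lerBrDl; apply: ler_piMl.
      by rewrite subr_ge0.
    by case/andP: alpha01 => _ /ltW.
  rewrite addnS -alphab; apply: y_step => //; first exact: stable.
  by left; apply: leC.
case: (eqVneq C finset.set0) => [C0 | Cn0].
  by exists C; split=> //; rewrite C0 cards0.
have CL : C \subset ~: L.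
  by apply: subset_trans CN _; rewrite /normal finset.setCU subsetIl.
have [i iC [S [SiA FS leb]]] : exists2 i, i \in C & exists S : {set 'I_n},
    [/\ S \subset in_nbrs e i :\: A, (F < #|S|)%N &
        forall j, j \in S -> y (t + k)%N j <= b].
  (* Either [F + 1] in-neighbours are leaders, at [c <= b], or [2 * F + 1] lie outside [C]; at most
     [F] of these are in [A], and the rest are at most [b]. *)
  case: (robust Cn0 CL) => [[i iC iL] | [i iC iC']]; exists i => //.
    exists (in_nbrs e i :&: L); split; last 1 first.
    - move=> j; rewrite inE => /andP[_ jL].
      by rewrite y_leader // (leq_trans tCt) ?leq_addr.
    - apply/subsetP => j; rewrite !inE => /andP[-> jL].
      by rewrite leader_notinA.
    - by rewrite -addn1.
  exists ((in_nbrs e i :\: C) :\: A); split; last 1 first.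
  - by move=> j; rewrite !inE => /and3P[jA jC _]; apply: leC.
  - by apply: finset.setSD; apply: subsetDl.
  - have := cardsID A (in_nbrs e i :\: C).
    have : (#|(in_nbrs e i :\: C) :&: A| <= F)%N.
      apply: leq_trans (local (subsetP CN _ iC)); apply: subset_leq_card.
      apply: finset.setSI; apply: subset_trans (subsetDl _ _) _.
      exact: subsetUr.
    by move: iC'; lia.
exists (C :\ i); split.
- by apply: subset_trans CN; apply: subsetDl.
- by move: cardC; rewrite (cardsD1 i) iC; lia.
move=> j jA; rewrite !inE negb_and negbK => /orP[/eqP-> | jC]; last exact: outside.
rewrite addnS -alphab; apply: y_step => //; first exact: (subsetP CN).
  exact: stable.
by right; exists S.
Qed.

Lemma upper_bound_geometric t M k : (tC <= t)%N -> c <= M ->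
  (forall j, j \notin A -> y t j <= M) ->
  forall j, j \notin A ->
    y (t + k * n)%N j <= c + (1 - alpha ^+ n) ^+ k * (M - c).
Proof.
move=> tCt cM leM; elim: k => [|k IHk] j jA.
  by rewrite mul0n addn0 expr0 mul1r addrC subrK leM.
set M' := c + (1 - alpha ^+ n) ^+ k * (M - c) in IHk.
have cM' : c <= M'.
  rewrite lerDl mulr_ge0 ?subr_ge0 // exprn_ge0 // subr_ge0.
  by case/andP: alpha01 => _ /ltW alpha1; rewrite exprn_ile1.
have tCt' : (tC <= t + k * n)%N by rewrite (leq_trans tCt) ?leq_addr.
(* Restarting from [M'] for [n] steps leaves at most [n - n = 0] exceptions. *)
have [C [_ cardC leC]] := shrinking_set n tCt' cM' IHk.
have C0 : j \notin C.
  by move: cardC; rewrite subnn leqn0 cards_eq0 => /eqP->; rewrite inE.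
rewrite mulSnr addnA; apply: le_trans (leC j jA C0) _.
by rewrite /M' exprS le_eqVlt; apply/orP; left; apply/eqP; ring.
Qed.

Lemma eventually_le eps i : 0 < eps -> i \notin A ->
  \forall t \near \oo, y t i <= c + eps.
Proof.
(* Taking [c] as the default of the maximum secures [c <= M]. *)
move=> eps0 iA; pose M := \big[Num.max/c]_j y tC j.
have cM : c <= M by apply: bigmax_ge_id.
have leM j : j \notin A -> y tC j <= M by move=> _; apply: le_bigmax.
have rho_cvg : (1 - alpha ^+ n) ^+ k * (M - c) @[k --> \oo] --> (0 : R).
  rewrite -[X in _ --> X](mul0r (M - c)); apply: cvgMl; apply: cvg_expr.
  have an0 : 0 < alpha ^+ n by rewrite exprn_gt0 //; case/andP: alpha01.
  have an1 : alpha ^+ n <= 1.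
    by case/andP: alpha01 => _ /ltW ?; rewrite exprn_ile1.
  by rewrite ger0_norm ?subr_ge0 // ltrBlDr ltrDl.
have [k _ /(_ k (leqnn k))] : \forall k \near \oo,
    (1 - alpha ^+ n) ^+ k * (M - c) <= eps.
  by move/cvgrPdist_le/(_ _ eps0): rho_cvg; apply: filterS => k;
    rewrite sub0r normrN => /(le_trans (ler_norm _)).
(* The geometric estimate covers only the times [tC + k * n]; once [c + eps] is a bound at such a
   time, stability carries it to all later ones. *)
move=> rho_eps; exists (tC + k * n)%N => // t /= leTt.
have tCT : (tC <= tC + k * n)%N by rewrite leq_addr.
have ceps : c <= c + eps by rewrite lerDl ltW.
rewrite -(subnKC leTt); apply: (upper_bound_stable tCT ceps) => // j jA.
by apply: le_trans (upper_bound_geometric k _ cM leM jA) _ => //; rewrite lerD2l.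
Qed.

End Contraction.

(** * Application to the W-MSR dynamics and its mirror image *)

Lemma received_truthful (R : realType) (n : nat) (e : rel 'I_n) (A : {set 'I_n})
    (x : nat -> 'I_n -> R) (m : nat -> 'I_n -> 'I_n -> R) t i j :
  truthful e A x m -> j \in incl_nbrs e i :\: A -> received x m t i j = x t j.
Proof.
move=> xm; rewrite /received !inE => /andP[jA].
by case: eqVneq => [-> // | _ /= eji]; apply: xm.
Qed.

(** [v] is abstract so as to cover the received values and their opposites. Bounds on states pass to
    [v] because they concern only agents outside [A], whose values arrive unaltered. *)
Lemma wmsr_contracting_above (R : realType) (n F : nat) (e : rel 'I_n)
    (L A : {set 'I_n}) (alpha : R) (y : nat -> 'I_n -> R)
    (v : nat -> 'I_n -> 'I_n -> R) (w : nat -> 'I_n -> 'I_n -> R)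
    (K : nat -> 'I_n -> {set 'I_n}) :
  0 <= alpha -> F_local e F L A ->
  (forall t i j, j \in incl_nbrs e i :\: A -> v t i j = y t j) ->
  (forall t i, i \in normal L A ->
    [/\ wmsr_retains F (incl_nbrs e i) (v t i) (y t i) (K t i),
        admissible_weights alpha (K t i) (w t i) &
        y t.+1 i = \sum_(j in K t i) w t i j * v t i j]) ->
  contracting_above e F L A alpha y.
Proof.
move=> alpha0 local vy wmsr t i M b iN bM leM low.
have iJA : i \in incl_nbrs e i :\: A.
  by move: iN; rewrite !inE eqxx negb_or => /andP[_ ->].
have [ret adm ->] := wmsr t i iN.
rewrite -(vy _ _ _ iJA) in ret low.
apply: (wmsr_update_le alpha0 bM iJA (local _ iN) ret adm).
  by move=> j jJA; rewrite vy //; apply: leM; move: jJA; rewrite inE => /andP[].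
case: low => [vib | [S [SJA FS leb]]]; [by left | right].
have SJ : S \subset incl_nbrs e i :\: A.
  by apply: subset_trans SJA _; apply: finset.setSD; apply: subsetUr.
exists S; split=> // [|j jS]; first exact: subset_trans SJ (subsetDl _ _).
by rewrite vy ?leb // (subsetP SJ).
Qed.

Theorem theorem2 (R : realType) (F n : nat) (e : rel 'I_n) (L A : {set 'I_n})
    (fr : nat -> R -> R) (xr : nat -> R) (x : nat -> 'I_n -> R)
    (m : nat -> 'I_n -> 'I_n -> R) (alpha : R)
    (w : nat -> 'I_n -> 'I_n -> R) (K : nat -> 'I_n -> {set 'I_n})
    (tC : nat) (CL : R)
    (He : irreflexive e)
    (Halpha : 0 < alpha < 1)
    (Hxr : forall t, xr t.+1 = fr t (xr t))
    (Hleaders : leaders_follow L A xr x)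
    (Htruthful : truthful e A x m)
    (Htrusted : L :&: A = finset.set0)
    (Hlocal : F_local e F L A)
    (Hwmsr : forall i, i \in normal L A -> applies_wmsr e F alpha x m w K i)
    (HxrC : forall t, (tC <= t)%N -> xr t = CL)
    (Hrobust : tlf_robust e F L) :
  forall i, i \in normal L A ->
    `|x t i - xr t| @[t --> \oo] --> (0 : R).
Proof.
move=> i iN; have iA : i \notin A.
  by move: iN; rewrite !inE negb_or => /andP[].
have alpha0 : 0 <= alpha by case/andP: Halpha => /ltW.
have leader t j : (tC <= t)%N -> j \in L -> x t j = CL.
  move=> tCt jL; rewrite -(HxrC t tCt) Hleaders // inE jL andbT.
  by apply/negP => jA; have := in_set0 j; rewrite -Htrusted inE jL jA.
have above : contracting_above e F L A alpha x.
  apply: (wmsr_contracting_above (v := received x m) alpha0 Hlocal).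
    by move=> t k j; apply: received_truthful.
  by move=> t k kN; apply: Hwmsr.
have below : contracting_above e F L A alpha (fun t j => - x t j).
  apply: (wmsr_contracting_above (v := fun t k j => - received x m t k j)
            (w := w) (K := K) alpha0 Hlocal) => [t k j kJA|t k kN].
    by congr (- _); apply: received_truthful kJA.
  have [ret adm ->] := Hwmsr k kN t; split=> //; first exact: wmsr_retains_opp.
  by rewrite -sumrN; apply: eq_bigr => j _; rewrite mulrN.
apply/cvgrPdist_le => eps eps0; near=> t.
have tCt : (tC <= t)%N by near: t; exists tC.
rewrite sub0r normrN normr_id HxrC // ler_norml.
apply/andP; split; last first.
  rewrite lerBlDl; near: t.
  exact: (eventually_le Halpha Htrusted Hlocal Hrobust above leader).
rewrite lerNl opprB -lerBrDl [eps - CL]addrC; near: t.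
(* The lower bound on [x] is the upper bound on [- x], whose leaders sit at [- CL]. *)
apply: (eventually_le Halpha Htrusted Hlocal Hrobust below (tC := tC)) => // t j tCt jL.
by rewrite leader.
Unshelve. all: by end_near.
Qed.
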